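(* Let $S^{(A)},S^{(B)}$ be finite-dimensional quantum systems with Hamiltonians $H^{(A)},H^{(B)}$, and let $\beta^{(A)},\beta^{(B)}\in(0,\infty)$ be inverse temperatures. The set of semilocal thermal operations with respect to $(\beta^{(A)},\beta^{(B)})$ is convex: if $\Lambda_1^{(AB)}$ and $\Lambda_2^{(AB)}$ are semilocal thermal operations with respect to $(\beta^{(A)},\beta^{(B)})$, then for every $\alpha\in[0,1]$ the map $\alpha\Lambda_1^{(AB)}+(1-\alpha)\Lambda_2^{(AB)}$ is a semilocal thermal operation with respect to the same pair $(\beta^{(A)},\beta^{(B)})$.
   Context: The joint system $S=S^{(A)}\otimes S^{(B)}$ has Hamiltonian $H^{(A)}+H^{(B)}$ (each term extended by identities). A map $\Lambda^{(AB)}$ on states of $S$ is a semilocal thermal operation (SLTO) with respect to local inverse temperatures $\beta^{(A)},\beta^{(B)}$ if there exist two bath systems $\mathcal B^{(A)},\mathcal B^{(B)}$ with Hamiltonians $H^{\mathcal B^{(A)}},H^{\mathcal B^{(B)}}$ and a unitary $U$ on baths and system such that $$\Lambda^{(AB)}(\rho)=\mathrm{Tr}_{\mathcal B^{(A)},\mathcal B^{(B)}}\big[U(\gamma^{\mathcal B^{(A)}}\otimes\gamma^{\mathcal B^{(B)}}\otimes\rho)U^\dagger\big],$$ where $\gamma^{\mathcal B^{(X)}}=e^{-\beta^{(X)}H^{\mathcal B^{(X)}}}/\mathrm{Tr}(e^{-\beta^{(X)}H^{\mathcal B^{(X)}}})$ for $X\in\{A,B\}$, and $$[U,H^{(A)}+H^{(B)}+H^{\mathcal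 B^{(A)}}+H^{\mathcal B^{(B)}}]=0,\qquad [U,\beta^{(A)}(H^{(A)}+H^{\mathcal B^{(A)}})+\beta^{(B)}(H^{(B)}+H^{\mathcal B^{(B)}})]=0.$$ The baths, their Hamiltonians and $U$ may depend on the operation. *)

(* Defs.v *)
From mathcomp Require Import all_boot all_order all_algebra.
From mathcomp Require Import complex mxtens.
From mathcomp Require Import all_classical all_reals all_analysis.
Set Implicit Arguments.
Unset Strict Implicit.
Unset Printing Implicit Defensive.
Import Order.TTheory GRing.Theory Num.Theory numFieldNormedType.Exports.
Local Open Scope classical_set_scope.
Local Open Scope ring_scope.
Local Open Scope complex_scope.
Local Open Scope sesquilinear_scope.

(* A system of dimension n has Hilbert space C^n with C = R[i]; operators are *)
(* n x n matrices acting on column vectors. A composite system is indexed by  *)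
(* a product of dimensions through mxtens_index; all products nest to the     *)
(* right, so baths and system form n1 * (n2 * (dA * dB)), in the order        *)
(* bath A, bath B, system A, system B.                                        *)

Section QuantumMechanics.
Variable R : realType.

(* Positivity uses the order of R[i]: 0 <= z means z is real and nonnegative. *)
Definition is_state n (rho : 'M[R[i]]_n) : Prop :=
  [/\ rho \is hermsymmx,
      forall v : 'cV[R[i]]_n, 0 <= (v ^t* *m rho *m v) ord0 ord0 &
      \tr rho = 1].

Definition expmx n (X : 'M[R[i]]_n) : 'M[R[i]]_n :=
  limn (series (fun k : nat => k`!%:R^-1 *: X ^+ k)).

Definition gibbs n (beta : R) (H : 'M[R[i]]_n) : 'M[R[i]]_n :=
  (\tr (expmx (- (beta%:C *: H))))^-1 *: expmx (- (beta%:C *: H)).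

(* Partial trace over the first tensor factor. *)
Definition ptrace m n (X : 'M[R[i]]_(m * n)) : 'M[R[i]]_n :=
  \matrix_(i, j) \sum_(k < m) X (mxtens_index (k, i)) (mxtens_index (k, j)).

Section Embeddings.
Variables n1 n2 dA dB : nat.

Definition on_bathA (X : 'M[R[i]]_n1) : 'M[R[i]]_(n1 * (n2 * (dA * dB))) :=
  X *t 1%:M.
Definition on_bathB (X : 'M[R[i]]_n2) : 'M[R[i]]_(n1 * (n2 * (dA * dB))) :=
  1%:M *t (X *t 1%:M).
Definition on_sysA (X : 'M[R[i]]_dA) : 'M[R[i]]_(n1 * (n2 * (dA * dB))) :=
  1%:M *t (1%:M *t (X *t 1%:M)).
Definition on_sysB (X : 'M[R[i]]_dB) : 'M[R[i]]_(n1 * (n2 * (dA * dB))) :=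
  1%:M *t (1%:M *t (1%:M *t X)).

End Embeddings.

Definition total_energy n1 n2 dA dB
    (K1 : 'M[R[i]]_n1) (K2 : 'M[R[i]]_n2)
    (HA : 'M[R[i]]_dA) (HB : 'M[R[i]]_dB) :
    'M[R[i]]_(n1 * (n2 * (dA * dB))) :=
  on_sysA _ _ _ HA + on_sysB _ _ _ HB + on_bathA _ _ _ K1 + on_bathB _ _ _ K2.

Definition weighted_energy (betaA betaB : R) n1 n2 dA dB
    (K1 : 'M[R[i]]_n1) (K2 : 'M[R[i]]_n2)
    (HA : 'M[R[i]]_dA) (HB : 'M[R[i]]_dB) :
    'M[R[i]]_(n1 * (n2 * (dA * dB))) :=
  betaA%:C *: (on_sysA _ _ _ HA + on_bathA _ _ _ K1)
  + betaB%:C *: (on_sysB _ _ _ HB + on_bathB _ _ _ K2).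

(* A map on states is given by a function on matrices of which only the       *)
(* values at states matter. Baths are finite-dimensional of dimension at      *)
(* least 1, so that their partition functions are nonzero.                    *)
Definition is_SLTO (betaA betaB : R) dA dB
    (HA : 'M[R[i]]_dA) (HB : 'M[R[i]]_dB)
    (Lambda : 'M[R[i]]_(dA * dB) -> 'M[R[i]]_(dA * dB)) : Prop :=
  exists (n1 n2 : nat) (K1 : 'M[R[i]]_n1) (K2 : 'M[R[i]]_n2)
         (U : 'M[R[i]]_(n1 * (n2 * (dA * dB)))),
    [/\ (0 < n1)%N /\ (0 < n2)%N,
        K1 \is hermsymmx /\ K2 \is hermsymmx,
        U \is unitarymx,
        comm_mx U (total_energy K1 K2 HA HB) /\
        comm_mx U (weighted_energy betaA betaB K1 K2 HA HB) &
        forall rho, is_state rho ->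
          Lambda rho =
            ptrace (ptrace
              (U *m (gibbs betaA K1 *t (gibbs betaB K2 *t rho)) *m U ^t*))].

End QuantumMechanics.

(* Main.v *)
(* In energy eigenbases of the two baths, U becomes a matrix of blocks V k l    *)
(* acting on the system, and being a semilocal thermal operation becomes a      *)
(* condition on these blocks and on the bath energies alone. The mixture is     *)
(* realized with bath A the direct sum of the two baths A, the first one        *)
(* shifted by a constant energy, and bath B the tensor product of the two       *)
(* baths B; U acts on the i-th summand of bath A as U_i and leaves the unused   *)
(* factor of bath B alone. The shift does not affect the commutation relations, *)
(* since U preserves the summands, and adjusts the Gibbs weights of the         *)
(* summands to any alpha in ]0, 1[.                                             *)

Require Import Defs.
From mathcomp Require Import all_boot all_order all_algebra.
From mathcomp Require Import complex mxtens.
From mathcomp Require Import all_classical all_reals all_analysis.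
From mathcomp Require Import ring.
Set Implicit Arguments.
Unset Strict Implicit.
Unset Printing Implicit Defensive.
Import Order.TTheory GRing.Theory Num.Theory numFieldNormedType.Exports.
Local Open Scope ring_scope.
Local Open Scope complex_scope.
Local Open Scope sesquilinear_scope.

(** The Gibbs state of a direct sum of Hamiltonians is a mixture of the Gibbs states of the
    summands, weighted by their shares of the partition function. A bath that is a direct sum
    therefore acts as a biased coin, and a unitary preserving the summands can use it to choose
    between the two operations; a constant shift of one summand sets the bias. Only bath A has to
    carry the coin: bath B holds both baths B at once, the one not selected being idle, so the joint
    bath stays a product.

    In energy eigenbases the thermal state of the joint bath has weights proportional to
    [expR (- F k)], where [F], of the form [betaA * a + betaB * b], is also the bath part of the
    second conserved quantity. Two real functions [E] and [F] on a finite set thus record all the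
    bath data ([thermal_blocks]). [SLTO_thermal_blocks] and [thermal_blocks_SLTO] translate from and
    to this form. Within it, [thermal_blocks_pad] adjoins an idle bath, [thermal_blocks_mix] forms
    the direct sum, and [thermal_blocks_convex] checks that the resulting energies again split into
    a bath A term and a bath B term. *)

(** * Exponentials and Gibbs states of Hermitian matrices *)

Lemma cvg_real_complex (R : realType) (u : nat -> R) (l : R) :
  (u @ \oo --> l)%classic ->
  ((fun N => (u N)%:C : (R[i] : numFieldType)) @ \oo -->
    (l%:C : (R[i] : numFieldType)))%classic.
Proof.
move=> /cvgrPdist_lt ul; apply/cvgrPdist_lt => e e0.
have eE : e = (complex.Re e)%:C by rewrite RRe_real // gtr0_real.
have e0' : 0 < complex.Re e by rewrite -ltcR -eE.
apply: filterS (ul _ e0') => N; rewrite -rmorphB normc_def /= expr0n addr0.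
by rewrite sqrtr_sqr {2}eE ltcR.
Qed.

Section UnitaryConjugation.
Variables (C : numClosedFieldType) (n : nat) (P : 'M[C]_n).
Hypothesis P_unit : P \is unitarymx.

Lemma mulmx_unitary_tC : P *m P^t* = 1%:M.
Proof. exact/unitarymxP. Qed.

Lemma mulmx_tC_unitary : P^t* *m P = 1%:M.
Proof. exact/mulmx1C/unitarymxP. Qed.

Lemma mulmx_unitary_conj (A B : 'M[C]_n) :
  (P^t* *m A *m P) *m (P^t* *m B *m P) = P^t* *m (A *m B) *m P.
Proof. by rewrite -!mulmxA [P *m (_ *m _)]mulmxA mulmx_unitary_tC mul1mx. Qed.

Definition udiag (v : 'rV[C]_n) : 'M[C]_n := P^t* *m diag_mx v *m P.

(** Spectral resolution: the rank-one matrices do not depend on [v], so limits of matrices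
    [udiag P v] reduce to limits of scalars. *)
Lemma udiagE v : udiag v = \sum_i v 0 i *: (col i (P^t*) *m row i P).
Proof.
apply/matrixP => s t; rewrite /udiag mul_mx_diag mxE summxE.
by apply: eq_bigr => i _; rewrite !mxE big_ord1 !mxE mulrAC mulrC.
Qed.

Lemma udiagX v k : udiag v ^+ k = udiag (\row_i v 0 i ^+ k).
Proof.
elim: k => [|k IH].
  rewrite expr0 /udiag (_ : diag_mx _ = 1%:M) ?mulmx1 ?mulmx_tC_unitary //.
  by apply/matrixP => s t; rewrite !mxE expr0.
rewrite exprS IH /udiag -[_ * _]/(_ *m _) mulmx_unitary_conj mulmx_diag.
congr (_ *m diag_mx _ *m _).
by apply/rowP => i; rewrite !mxE exprS.
Qed.

Lemma udiagZ c v : c *: udiag v = udiag (c *: v).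
Proof. by rewrite /udiag linearZ /= -scalemxAr -scalemxAl. Qed.

Lemma mxtrace_udiag v : \tr (udiag v) = \sum_i v 0 i.
Proof.
by rewrite /udiag -mulmxA mxtrace_mulC -mulmxA mulmx_unitary_tC mulmx1 mxtrace_diag.
Qed.

End UnitaryConjugation.

Lemma udiag1 (C : numClosedFieldType) n (v : 'rV[C]_n) : udiag 1%:M v = diag_mx v.
Proof. by rewrite /udiag trmx1 map_mx1 mul1mx mulmx1. Qed.

Lemma unitarymx1 (C : numClosedFieldType) n : (1%:M : 'M[C]_n) \is unitarymx.
Proof. by apply/unitarymxP; rewrite trmx1 map_mx1 mul1mx. Qed.

Lemma hermitian_udiag (C : numClosedFieldType) n (K : 'M[C]_n) :
  K \is hermsymmx -> K = udiag (spectralmx K) (spectral_diag K).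
Proof.
move=> Kh; have /orthomx_spectralP {1}-> := hermitian_normalmx Kh.
by rewrite invmx_unitary ?spectral_unitarymx.
Qed.

(* Stated over an abstract field: over R[i] itself, unification gets lost among *)
(* the structures on 'M[R[i]]_(m, n).                                           *)
Lemma limn_sum_scaler (K : numFieldType) m n (I : finType)
    (c : nat -> I -> K) (l : I -> K) (M : I -> 'M[K]_(m, n)) :
  (forall i, (fun N => c N i) @ \oo --> l i)%classic ->
  (limn (fun N => \sum_i c N i *: M i))%classic = \sum_i l i *: M i.
Proof.
move=> cl; apply: cvg_lim; first exact: norm_hausdorff.
apply: cvg_big => [|i _]; first exact: add_continuous.
by apply: cvgZr_tmp; exact: cl.
Qed.

Definition real_row (R : realType) n (a : 'I_n -> R) : 'rV[R[i]]_n := \row_i (a i)%:C.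

Lemma real_rowZ (R : realType) n (c : R) (a : 'I_n -> R) :
  c%:C *: real_row a = real_row (fun i => c * a i).
Proof. by apply/rowP => i; rewrite !mxE rmorphM. Qed.

Lemma real_rowN (R : realType) n (a : 'I_n -> R) : - real_row a = real_row (fun i => - a i).
Proof. by apply/rowP => i; rewrite !mxE rmorphN. Qed.

Lemma diag_real_row_hermsymmx (R : realType) n (a : 'I_n -> R) :
  diag_mx (real_row a) \is hermsymmx.
Proof.
apply/is_hermitianmxP; rewrite expr0 scale1r tr_diag_mx map_diag_mx; congr diag_mx.
by apply/rowP => i; rewrite !mxE; exact/esym/conjc_real.
Qed.

Section GibbsDiag.
Variables (R : realType) (n : nat) (P : 'M[R[i]]_n).
Hypothesis P_unit : P \is unitarymx.

(** After exchanging the two sums, each partial sum is a combination of fixed rank-one matrices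
    whose coefficients are partial sums of the real exponential series. *)
Lemma expmx_udiag (a : 'I_n -> R) :
  expmx (udiag P (real_row a)) = udiag P (real_row (fun i => expR (a i))).
Proof.
rewrite /expmx (_ : series _ = fun N =>
    \sum_i (series (exp_coeff (a i)) N)%:C *: (col i (P^t*) *m row i P)).
  rewrite udiagE; under [RHS]eq_bigr do rewrite mxE.
  apply: (@limn_sum_scaler R[i]) => i.
  by apply: cvg_real_complex; exact: is_cvg_series_exp_coeff.
apply/funext => N; rewrite /series /=.
under [RHS]eq_bigr do rewrite rmorph_sum scaler_suml.
rewrite exchange_big /=; apply: eq_bigr => k _.
rewrite (udiagX P_unit) udiagE scaler_sumr; apply: eq_bigr => i _.
by rewrite scalerA !mxE exp_coeffE /= rmorphM fmorphV rmorph_nat rmorphXn.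
Qed.

Lemma gibbs_udiag beta (a : 'I_n -> R) : gibbs beta (udiag P (real_row a)) =
  udiag P (real_row (fun i => expR (- (beta * a i)) / \sum_j expR (- (beta * a j)))).
Proof.
rewrite /gibbs; set X := (X in expmx X).
have -> : X = udiag P (real_row (fun i => - (beta * a i))).
  by rewrite /X -real_rowN -scaleN1r udiagZ udiagZ scaleN1r real_rowZ.
rewrite expmx_udiag (mxtrace_udiag P_unit).
under [X in X^-1]eq_bigr do rewrite mxE.
rewrite -rmorph_sum -fmorphV udiagZ real_rowZ; congr (udiag P (real_row _)).
by apply/funext => i; rewrite mulrC.
Qed.

End GibbsDiag.

Lemma hermitian_udiag_real (R : realType) n (K : 'M[R[i]]_n) : K \is hermsymmx ->
  exists P a, P \is unitarymx /\ K = udiag P (real_row a).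
Proof.
move=> Kh; exists (spectralmx K), (fun i => complex.Re (spectral_diag K 0 i)).
split; first exact: spectral_unitarymx.
rewrite {1}(hermitian_udiag Kh); congr udiag.
apply/rowP => i; rewrite !mxE RRe_real //.
exact: (mxOverP (hermitian_spectral_diag_real Kh)).
Qed.

(** * Partition functions, and operations written as blocks over bath energy levels *)

(** Inverse temperatures are absorbed into [F], since a joint bath at two temperatures has no single
    [beta] to factor out. *)
Definition partition_function (R : realType) (K : finType) (F : K -> R) : R :=
  \sum_k expR (- F k).

Lemma partition_function_gt0 (R : realType) (K : finType) (F : K -> R) :
  (0 < #|K|)%N -> 0 < partition_function F.
Proof.
move=> /card_gt0P[k _]; rewrite /partition_function (bigD1 k) //=.
by rewrite ltr_pwDl ?expR_gt0 // sumr_ge0 // => l _; exact: expR_ge0.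
Qed.

Lemma partition_functionD (R : realType) (I J : finType) (f : I -> R) (g : J -> R) :
  partition_function (fun x : I * J => f x.1 + g x.2) =
  partition_function f * partition_function g.
Proof.
rewrite /partition_function big_distrlr pair_bigA /=.
by apply: eq_bigr => x _; rewrite opprD expRD.
Qed.

Section Blocks.
Variables (R : realType) (d : nat) (H W : 'M[R[i]]_d).
Implicit Types Lambda : 'M[R[i]]_d -> 'M[R[i]]_d.

(* Coordinates of a semilocal thermal operation when the joint bath Hamiltonian *)
(* is diagonal: K indexes the bath energy eigenbasis, V k l is the block        *)
(* <k|U|l> of the unitary acting on the system, E and F are the bath parts of   *)
(* the total and of the beta-weighted energy. The clauses say that U is         *)
(* unitary, that it commutes with both energies, and that tracing out the bath  *)
(* gives Lambda.                                                                *)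
Definition thermal_blocks (K : finType) (E F : K -> R) Lambda : Prop :=
  exists V : K -> K -> 'M[R[i]]_d,
    [/\ forall k k', \sum_l V k l *m (V k' l)^t* = (k == k')%:R%:M,
        forall k l, V k l *m H + (E l)%:C *: V k l = H *m V k l + (E k)%:C *: V k l,
        forall k l, V k l *m W + (F l)%:C *: V k l = W *m V k l + (F k)%:C *: V k l &
        forall rho, is_state rho -> Lambda rho =
          \sum_k \sum_l (expR (- F l) / partition_function F)%:C
             *: (V k l *m rho *m (V k l)^t*)].

Lemma thermal_blocks_reindex (K K' : finType) (g : K' -> K) (E F : K -> R)
    (E' F' : K' -> R) Lambda : bijective g ->
  E' =1 E \o g -> F' =1 F \o g ->
  thermal_blocks E F Lambda -> thermal_blocks E' F' Lambda.
Proof.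
move=> gbij /funext-> /funext-> [V [unitV VE VF VL]].
have gon : {on [pred _ | true], bijective g} by exact: onW_bij.
have pF : partition_function (F \o g) = partition_function F.
  by rewrite /partition_function [RHS](reindex g).
exists (fun k l => V (g k) (g l)); split => [k k'|k l|k l|rho /VL ->] //=.
- rewrite -(inj_eq (bij_inj gbij)) -unitV [RHS](reindex g) //.
- rewrite (reindex g) //; apply: eq_bigr => k _; rewrite (reindex g) //.
  by apply: eq_bigr => l _; rewrite pF.
Qed.

(** The unitary is extended by the identity on [J]. Blocks with distinct [J] indices vanish, and the
    Gibbs weights of [f] sum to 1, which needs [J] nonempty. *)
Lemma thermal_blocks_pad (K J : finType) (E F : K -> R) (e f : J -> R) Lambda :
  (0 < #|J|)%N -> thermal_blocks E F Lambda ->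
  thermal_blocks (fun x : K * J => E x.1 + e x.2) (fun x => F x.1 + f x.2) Lambda.
Proof.
move=> J0 [V [unitV VE VF VL]].
have pF := partition_functionD F f.
exists (fun x y => if x.2 == y.2 then V x.1 y.1 else 0).
split => [[k j] [k' j']|[k j] [l j']|[k j] [l j']|rho /VL ->] /=.
- transitivity (\sum_l \sum_i ((if j == i then V k l else 0) *m
     (if j' == i then V k' l else 0)^t*)).
    by rewrite pair_bigA.
  rewrite xpair_eqE; have [<-|jj'] := eqVneq j j'; last first.
    rewrite andbF mulr0n raddf0; apply: big1 => l _; apply: big1 => i _.
    have [<-|_] := eqVneq j i; last by rewrite mul0mx.
    by rewrite eq_sym (negPf jj') trmx0 map_mx0 mulmx0.
  rewrite andbT -unitV; apply: eq_bigr => l _; rewrite (bigD1 j) //= eqxx.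
  by rewrite big1 ?addr0 // => i /negPf ij; rewrite eq_sym ij mul0mx.
- have [->|_] := eqVneq j j'; last by rewrite mul0mx mulmx0 !scaler0.
  by rewrite !rmorphD /= !scalerDl !addrA VE.
- have [->|_] := eqVneq j j'; last by rewrite mul0mx mulmx0 !scaler0.
  by rewrite !rmorphD /= !scalerDl !addrA VF.
- pose G k j l i := (expR (- (F l + f i)) / (partition_function F * partition_function f))%:C *:
     ((if j == i then V k l else 0) *m rho *m (if j == i then V k l else 0)^t*).
  transitivity (\sum_k \sum_j \sum_l \sum_i G k j l i); last first.
    rewrite pair_bigA; apply: eq_bigr => x _; rewrite pair_bigA pF //.
  apply: eq_bigr => k _; rewrite exchange_big; apply: eq_bigr => l _ /=.
  transitivity (\sum_j (expR (- (F l + f j)) / (partition_function F * partition_function f))%:C *: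
      (V k l *m rho *m (V k l)^t*)); last first.
    apply: eq_bigr => j _; rewrite (bigD1 j) //= big1 ?addr0 /G ?eqxx //.
    by move=> i /negPf ij; rewrite eq_sym ij !mul0mx scaler0.
  rewrite -scaler_suml -rmorph_sum -mulr_suml; congr (_%:C *: _).
  under eq_bigr do rewrite opprD expRD.
  rewrite -mulr_sumr -/(partition_function f).
  have := partition_function_gt0 f J0 => /lt0r_neq0 f0.
  by rewrite invfM mulrACA divff // mulr1.
Qed.

(** The blocks are those of a block-diagonal unitary, so constants [s] and [t] added on the first
    summand appear on both sides of each commutation relation. The equation on [t] says that this
    summand holds the share [alpha] of the partition function. *)
Lemma thermal_blocks_mix (K1 K2 : finType) (E1 F1 : K1 -> R) (E2 F2 : K2 -> R)
    (s t alpha : R) Lambda1 Lambda2 :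
  (0 < #|K1|)%N -> (0 < #|K2|)%N ->
  expR (- t) * partition_function F1 =
    alpha * (expR (- t) * partition_function F1 + partition_function F2) ->
  thermal_blocks E1 F1 Lambda1 -> thermal_blocks E2 F2 Lambda2 ->
  thermal_blocks
    (fun x : K1 + K2 => match x with inl k => E1 k + s | inr k => E2 k end)
    (fun x => match x with inl k => F1 k + t | inr k => F2 k end)
    (fun rho => alpha%:C *: Lambda1 rho + (1 - alpha)%:C *: Lambda2 rho).
Proof.
move=> K1_gt0 K2_gt0 tE [V1 [unitV1 VE1 VF1 VL1]] [V2 [unitV2 VE2 VF2 VL2]].
set F := fun x : K1 + K2 => match x with inl k => F1 k + t | inr k => F2 k end.
have pF : partition_function F =
    expR (- t) * partition_function F1 + partition_function F2.
  rewrite {1}/partition_function big_sumType /= mulr_sumr; congr (_ + _).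
  by apply: eq_bigr => k _; rewrite opprD expRD mulrC.
have Z1 := partition_function_gt0 F1 K1_gt0.
have Z2 := partition_function_gt0 F2 K2_gt0.
have Z : 0 < partition_function F by rewrite pF addr_gt0 // mulr_gt0 ?expR_gt0.
rewrite -pF in tE.
(* Gibbs weights of the sum are those of a summand times [alpha] or [1 - alpha]; here the factor
   [expR (- t)] cancels. *)
have w1 l : expR (- (F1 l + t)) / partition_function F =
    alpha * (expR (- F1 l) / partition_function F1).
  rewrite opprD expRD; apply/eqP; rewrite mulrA eqr_div ?lt0r_neq0 //.
  by rewrite -mulrA tE; apply/eqP; ring.
have w2 l : expR (- F2 l) / partition_function F =
    (1 - alpha) * (expR (- F2 l) / partition_function F2).
  apply/eqP; rewrite mulrA eqr_div ?lt0r_neq0 //; apply/eqP.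
  have -> : partition_function F2 = (1 - alpha) * partition_function F.
    by rewrite mulrBl mul1r -tE pF addrAC subrr add0r.
  by ring.
pose V (x y : K1 + K2) := match x, y with
  | inl k, inl l => V1 k l | inr k, inr l => V2 k l | _, _ => 0 end.
have zero2 (I : finType) (G : I -> 'M[R[i]]_d) : (forall i, G i = 0) -> \sum_i G i = 0.
  by move=> G0; rewrite big1.
have tr0 : (0 : 'M[R[i]]_d)^t* = 0 by rewrite trmx0 map_mx0.
exists V; split => [k k'|[k|k] [l|l]|[k|k] [l|l]|rho rhoS].
- rewrite big_sumType; case: k k' => [k|k] [k'|k'] /=.
  + by rewrite unitV1 [X in _ + X]zero2 ?addr0 // => i; rewrite mul0mx.
  + by rewrite !zero2 ?addr0 ?raddf0 // => i; rewrite ?tr0 ?mul0mx ?mulmx0.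
  + by rewrite !zero2 ?addr0 ?raddf0 // => i; rewrite ?tr0 ?mul0mx ?mulmx0.
  + by rewrite unitV2 [X in X + _]zero2 ?add0r // => i; rewrite mul0mx.
- by rewrite !rmorphD /= !scalerDl !addrA VE1.
- by rewrite /= mul0mx mulmx0 !scaler0.
- by rewrite /= mul0mx mulmx0 !scaler0.
- exact: VE2.
- by rewrite !rmorphD /= !scalerDl !addrA VF1.
- by rewrite /= mul0mx mulmx0 !scaler0.
- by rewrite /= mul0mx mulmx0 !scaler0.
- exact: VF2.
- rewrite VL1 // VL2 // !scaler_sumr big_sumType; congr (_ + _); apply: eq_bigr => k _.
    rewrite big_sumType /= [X in _ = _ + X]zero2 ?addr0; last first.
      by move=> i; rewrite !mul0mx scaler0.
    rewrite scaler_sumr; apply: eq_bigr => l _.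
    by rewrite scalerA -rmorphM w1.
  rewrite big_sumType /= [X in _ = X + _]zero2 ?add0r; last first.
    by move=> i; rewrite !mul0mx scaler0.
  rewrite scaler_sumr; apply: eq_bigr => l _.
  by rewrite scalerA -rmorphM w2.
Qed.

(** Each operation is padded with the other's bath B, so that both summands carry the same bath B
    energy [b1 + b2] and the choice of summand affects bath A only. *)
Lemma thermal_blocks_convex (betaA betaB alpha : R) (I1 J1 I2 J2 : finType)
    (a1 : I1 -> R) (b1 : J1 -> R) (a2 : I2 -> R) (b2 : J2 -> R)
    Lambda1 Lambda2 :
  betaA != 0 -> 0 < alpha < 1 ->
  (0 < #|I1|)%N -> (0 < #|J1|)%N -> (0 < #|I2|)%N -> (0 < #|J2|)%N ->
  thermal_blocks (fun x : I1 * J1 => a1 x.1 + b1 x.2)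
    (fun x => betaA * a1 x.1 + betaB * b1 x.2) Lambda1 ->
  thermal_blocks (fun x : I2 * J2 => a2 x.1 + b2 x.2)
    (fun x => betaA * a2 x.1 + betaB * b2 x.2) Lambda2 ->
  exists (a : I1 + I2 -> R) (b : J1 * J2 -> R),
  thermal_blocks (fun x => a x.1 + b x.2)
    (fun x => betaA * a x.1 + betaB * b x.2)
    (fun rho => alpha%:C *: Lambda1 rho + (1 - alpha)%:C *: Lambda2 rho).
Proof.
move=> bA /andP[al0 al1] hI1 hJ1 hI2 hJ2 L1 L2.
have P1 := thermal_blocks_pad b2 (fun j => betaB * b2 j) hJ2 L1.
have P2 := thermal_blocks_pad b1 (fun j => betaB * b1 j) hJ1 L2.
have c1 : (0 < #|{: (I1 * J1) * J2}|)%N by rewrite !card_prod !muln_gt0 hI1 hJ1 hJ2.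
have c2 : (0 < #|{: (I2 * J2) * J1}|)%N by rewrite !card_prod !muln_gt0 hI2 hJ1 hJ2.
set F1 := (F in thermal_blocks _ F Lambda1) in P1.
set F2 := (F in thermal_blocks _ F Lambda2) in P2.
have Z1 := partition_function_gt0 F1 c1.
have Z2 := partition_function_gt0 F2 c2.
(* The shift t is chosen so that the direct sum has Gibbs weights alpha and *)
(* 1 - alpha on its two summands.                                           *)
pose r := alpha * partition_function F2 / ((1 - alpha) * partition_function F1).
have r0 : 0 < r by rewrite divr_gt0 // mulr_gt0 ?subr_gt0.
pose t := - ln r.
have tE : expR (- t) * partition_function F1 =
    alpha * (expR (- t) * partition_function F1 + partition_function F2).
  rewrite /t opprK lnK ?posrE // /r.
  by field; rewrite lt0r_neq0 // lt0r_neq0 // subr_gt0.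
(* A shift of the bath A Hamiltonian by [t / betaA] moves the weighted energy by [t]; [betaA != 0]
   enters here. *)
have M := thermal_blocks_mix (t / betaA) c1 c2 tE P1 P2.
(* Distributivity of the product over the sum, with the idle bath B index placed last in each
   summand. *)
pose g (x : (I1 + I2) * (J1 * J2)) : (I1 * J1) * J2 + (I2 * J2) * J1 :=
  match x.1 with
  | inl i => inl ((i, x.2.1), x.2.2)
  | inr i => inr ((i, x.2.2), x.2.1) end.
exists (fun i => match i with inl i => a1 i + t / betaA | inr i => a2 i end).
exists (fun j => b1 j.1 + b2 j.2).
apply: (thermal_blocks_reindex (g := g)) M.
- exists (fun y => match y with
    | inl x => (inl x.1.1, (x.1.2, x.2)) | inr x => (inr x.1.1, (x.2, x.1.2)) end).
  + by move=> [[i|i] [j1 j2]].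
  + by move=> [[[i j1] j2]|[[i j1] j2]].
- by move=> [[i|i] [j1 j2]] /=; ring.
- by move=> [[i|i] [j1 j2]] /=; rewrite /F1 /F2 /=; field.
Qed.

End Blocks.

(** * Identities for tensor products, sums and traces *)

Lemma scalerDD (R : pzRingType) (V : lmodType R) (c d : R) (x y z t : V) :
  c *: (x + y) + d *: (z + t) = c *: x + d *: z + c *: y + d *: t.
Proof. by rewrite !scalerDr addrACA addrA. Qed.

Lemma big_mxtens_index (V : nmodType) m n (F : 'I_(m * n) -> V) :
  \sum_x F x = \sum_i \sum_j F (mxtens_index (i, j)).
Proof.
rewrite pair_bigA (reindex (@mxtens_index m n)) /=; last first.
  exists (@mxtens_unindex m n) => x _; [exact: mxtens_indexK | exact: mxtens_unindexK].
by apply: eq_bigr => -[i j].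
Qed.

Lemma tensmx1 (R : pzRingType) m n : (1%:M : 'M[R]_m) *t (1%:M : 'M[R]_n) = 1%:M.
Proof.
apply/matrixP => x y; case: (mxtens_indexP x) => i j; case: (mxtens_indexP y) => k l.
rewrite tensmxE !mxE (can_eq (@mxtens_indexK m n)) xpair_eqE -natrM.
by rewrite mulnb.
Qed.

Lemma tensmx_tC (C : numClosedFieldType) m n p q (A : 'M[C]_(m, n)) (B : 'M[C]_(p, q)) :
  (A *t B)^t* = A^t* *t B^t*.
Proof. by rewrite trmx_tens map_mxT. Qed.

Lemma tensmxDr (R : pzRingType) m n p q (A : 'M[R]_(m, n)) (B B' : 'M[R]_(p, q)) :
  A *t (B + B') = A *t B + A *t B'.
Proof. by apply/matrixP => x y; rewrite !mxE mulrDr. Qed.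

Lemma tensmxZr (R : comPzRingType) m n p q c (A : 'M[R]_(m, n)) (B : 'M[R]_(p, q)) :
  A *t (c *: B) = c *: (A *t B).
Proof. by apply/matrixP => x y; rewrite !mxE mulrCA. Qed.

Lemma tensmxZl (R : comPzRingType) m n p q c (A : 'M[R]_(m, n)) (B : 'M[R]_(p, q)) :
  (c *: A) *t B = c *: (A *t B).
Proof. by apply/matrixP => x y; rewrite !mxE mulrA. Qed.

Lemma mxtrace_mul_delta (R : comPzRingType) n (M : 'M[R]_n) i j :
  \tr (M *m delta_mx j i) = M i j.
Proof.
rewrite /mxtrace (bigD1 i) //= big1 ?addr0 => [|k ki].
  rewrite mxE (bigD1 j) //= big1 ?addr0 ?mxE ?eqxx ?mulr1 // => k kj.
  by rewrite mxE (negPf kj) mulr0.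
by rewrite mxE big1 // => l _; rewrite mxE (negPf ki) andbF mulr0.
Qed.

(** * Operators on baths and system as block matrices over bath indices *)

Section BathBlocks.
Variables (C : numClosedFieldType) (n1 n2 d : nat).
Local Notation bath := ('I_n1 * 'I_n2)%type.
Local Notation joint := (n1 * (n2 * d))%N.

Definition joint_index (k : bath) (s : 'I_d) : 'I_joint :=
  mxtens_index (k.1, mxtens_index (k.2, s)).

Definition joint_unindex (x : 'I_joint) : bath * 'I_d :=
  let: (i, y) := mxtens_unindex x in
  let: (j, s) := mxtens_unindex y in ((i, j), s).

Lemma joint_indexK k s : joint_unindex (joint_index k s) = (k, s).
Proof.
rewrite /joint_unindex /joint_index !mxtens_indexK.
by rewrite -surjective_pairing.
Qed.

Variant is_joint_index : 'I_joint -> Type :=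
  IsJointIndex k s : is_joint_index (joint_index k s).

Lemma joint_indexP x : is_joint_index x.
Proof.
case: (mxtens_indexP x) => i y; case: (mxtens_indexP y) => j s.
exact: (IsJointIndex (i, j)).
Qed.

Lemma big_joint_index (V : nmodType) (F : 'I_joint -> V) :
  \sum_x F x = \sum_k \sum_s F (joint_index k s).
Proof.
rewrite big_mxtens_index; under eq_bigr do rewrite big_mxtens_index.
by rewrite pair_bigA.
Qed.

Definition bath_block (X : 'M[C]_joint) (k l : bath) : 'M[C]_d :=
  \matrix_(s, t) X (joint_index k s) (joint_index l t).

Definition of_bath_blocks (V : bath -> bath -> 'M[C]_d) : 'M[C]_joint :=
  \matrix_(x, y) V (joint_unindex x).1 (joint_unindex y).1
                   (joint_unindex x).2 (joint_unindex y).2.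

Lemma of_bath_blocksK V k l : bath_block (of_bath_blocks V) k l = V k l.
Proof.
by apply/matrixP => s t; rewrite !mxE !joint_indexK.
Qed.

Lemma eq_bath_block X Y :
  (forall k l, bath_block X k l = bath_block Y k l) -> X = Y.
Proof.
move=> XY; apply/matrixP => x y.
case: (joint_indexP x) => k s; case: (joint_indexP y) => l t.
by have /matrixP/(_ s t) := XY k l; rewrite !mxE.
Qed.

Lemma bath_blockD X Y k l :
  bath_block (X + Y) k l = bath_block X k l + bath_block Y k l.
Proof. by apply/matrixP => s t; rewrite !mxE. Qed.

Lemma bath_blockM X Y k l :
  bath_block (X *m Y) k l = \sum_m bath_block X k m *m bath_block Y m l.
Proof.
apply/matrixP => s t; rewrite mxE mxE big_joint_index summxE.
by apply: eq_bigr => m _; rewrite mxE; apply: eq_bigr => u _; rewrite !mxE.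
Qed.

Lemma bath_block_tC X k l : bath_block (X^t*) k l = (bath_block X l k)^t*.
Proof. by apply/matrixP => s t; rewrite !mxE. Qed.

Lemma bath_block_tens A B X k l :
  bath_block (A *t (B *t X)) k l = (A k.1 l.1 * B k.2 l.2) *: X.
Proof. by apply/matrixP => s t; rewrite mxE /joint_index !tensmxE mxE mulrA. Qed.

Lemma bath_block_tens1 X k l :
  bath_block (1%:M *t (1%:M *t X)) k l = (k == l)%:R *: X.
Proof. by rewrite bath_block_tens !mxE -natrM mulnb -xpair_eqE -!surjective_pairing. Qed.

Lemma bath_block1 k l : bath_block 1%:M k l = (k == l)%:R%:M.
Proof. by rewrite -tensmx1 -tensmx1 bath_block_tens1 scalemx1. Qed.

Lemma unitarymx_bath_block U : reflect
  (forall k k', \sum_l bath_block U k l *m (bath_block U k' l)^t* = (k == k')%:R%:M)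
  (U \is unitarymx).
Proof.
have UU k k' : bath_block (U *m U^t*) k k' =
    \sum_l bath_block U k l *m (bath_block U k' l)^t*.
  by rewrite bath_blockM; apply: eq_bigr => l _; rewrite bath_block_tC.
apply: (iffP unitarymxP) => [U1 k k'|U1]; first by rewrite -UU U1 bath_block1.
by apply: eq_bath_block => k k'; rewrite UU U1 bath_block1.
Qed.

(** Common shape of both conserved quantities, which lets one commutation criterion serve for the
    two. *)
Definition joint_energy (K1 : 'M[C]_n1) (K2 : 'M[C]_n2) (X : 'M[C]_d) : 'M[C]_joint :=
  1%:M *t (1%:M *t X) + K1 *t 1%:M + 1%:M *t (K2 *t 1%:M).

Lemma bath_block_joint_energy v w X k l :
  bath_block (joint_energy (diag_mx v) (diag_mx w) X) k l =
  (k == l)%:R *: (X + (v 0 k.1 + w 0 k.2)%:M).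
Proof.
rewrite /joint_energy -tensmx1 !bath_blockD !bath_block_tens !mxE -addrA -scalerDl.
case: k l => [i j] [i' j'] /=; rewrite xpair_eqE.
have [_|_] /= := eqVneq i i'; last by rewrite !mulr0n !mul0r addr0 !scale0r addr0.
have [_|_] /= := eqVneq j j'; last by rewrite !mulr0n !mulr0 addr0 !scale0r addr0.
by rewrite !mulr1n !mulr1 !mul1r !scale1r scalemx1.
Qed.

(** With diagonal bath Hamiltonians the energy is block diagonal, each diagonal block being [X] plus
    a scalar; one term survives in each block of the two products. *)
Lemma comm_mx_bath_block U v w (X : 'M[C]_d) :
  comm_mx U (joint_energy (diag_mx v) (diag_mx w) X) <-> forall k l,
    bath_block U k l *m X + (v 0 l.1 + w 0 l.2) *: bath_block U k l =
    X *m bath_block U k l + (v 0 k.1 + w 0 k.2) *: bath_block U k l.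
Proof.
set E := joint_energy _ _ _.
have EE := bath_block_joint_energy v w X; rewrite -/E in EE.
have UE k l : bath_block (U *m E) k l =
    bath_block U k l *m X + (v 0 l.1 + w 0 l.2) *: bath_block U k l.
  rewrite bath_blockM (bigD1 l) //= big1 ?addr0 => [|m /negPf ml].
    by rewrite EE eqxx scale1r mulmxDr mul_mx_scalar.
  by rewrite EE ml scale0r mulmx0.
have EU k l : bath_block (E *m U) k l =
    X *m bath_block U k l + (v 0 k.1 + w 0 k.2) *: bath_block U k l.
  rewrite bath_blockM (bigD1 k) //= big1 ?addr0 => [|m /negPf mk].
    by rewrite EE eqxx scale1r mulmxDl mul_scalar_mx.
  by rewrite EE eq_sym mk scale0r mul0mx.
split=> [UEc k l|UV]; first by rewrite -UE -EU UEc.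
by apply: eq_bath_block => k l; rewrite UE EU.
Qed.

(** The input is block diagonal, its blocks being multiples of [rho], so the channel takes Kraus
    form. *)
Lemma sum_bath_block_channel U v w rho :
  \sum_k bath_block (U *m (diag_mx v *t (diag_mx w *t rho)) *m U^t*) k k =
  \sum_k \sum_l (v 0 l.1 * w 0 l.2) *:
    (bath_block U k l *m rho *m (bath_block U k l)^t*).
Proof.
apply: eq_bigr => k _; rewrite bath_blockM; apply: eq_bigr => l _.
rewrite bath_block_tC bath_blockM (bigD1 l) //= big1 ?addr0.
  by rewrite bath_block_tens !mxE !eqxx !mulr1n -scalemxAr -scalemxAl.
case: l => [i j] [i' j']; rewrite bath_block_tens !mxE /= xpair_eqE negb_and.
by case/orP => /negPf ->; rewrite mulr0n ?mul0r ?mulr0 scale0r mulmx0.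
Qed.

(* Writes the partial trace as traces, where cyclicity is available. *)
Lemma sum_bath_block_delta X s t :
  (\sum_k bath_block X k k) s t = \tr (X *m (1%:M *t (1%:M *t delta_mx t s))).
Proof.
rewrite /mxtrace big_joint_index summxE; apply: eq_bigr => k _.
rewrite -mxtrace_mul_delta /mxtrace; apply: eq_bigr => u _.
transitivity (bath_block (X *m (1%:M *t (1%:M *t delta_mx t s))) k k u u); last by rewrite mxE.
rewrite bath_blockM (bigD1 k) //= big1 ?addr0 => [|m /negPf mk].
  by rewrite bath_block_tens1 eqxx scale1r.
by rewrite bath_block_tens1 mk scale0r mulmx0.
Qed.

(** * Change to energy eigenbases of the baths *)

Section BathRotation.
Variables (P : 'M[C]_n1) (Q : 'M[C]_n2).
Hypotheses (P_unit : P \is unitarymx) (Q_unit : Q \is unitarymx).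

Definition bath_rotation : 'M[C]_joint := P *t (Q *t 1%:M).
Local Notation T := bath_rotation.

Lemma bath_rotation_unitary : T \is unitarymx.
Proof.
apply/unitarymxP; rewrite /T !tensmx_tC !tensmx_mul.
rewrite (mulmx_unitary_tC P_unit) (mulmx_unitary_tC Q_unit).
by rewrite trmx1 map_mx1 mul1mx !tensmx1.
Qed.

Lemma bath_rotation_conj_unitary U : U \is unitarymx -> T *m U *m T^t* \is unitarymx.
Proof.
by move=> Uu; rewrite !mul_unitarymx ?trmxC_unitary ?bath_rotation_unitary.
Qed.

Lemma bath_rotation_conj A B X :
  T^t* *m (A *t (B *t X)) *m T = (P^t* *m A *m P) *t ((Q^t* *m B *m Q) *t X).
Proof. by rewrite /T !tensmx_tC !tensmx_mul trmx1 map_mx1 mul1mx mulmx1. Qed.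

(** The rotation acts on the baths alone, so it commutes with every operator on the system and
    cancels by cyclicity of the trace. *)
Lemma sum_bath_block_rotation X :
  \sum_k bath_block (T^t* *m X *m T) k k = \sum_k bath_block X k k.
Proof.
apply/matrixP => s t; rewrite !sum_bath_block_delta.
set D := 1%:M *t _.
have TD : T *m D = D *m T by rewrite /T /D !tensmx_mul !mul1mx !mulmx1.
rewrite -mulmxA TD mulmxA mxtrace_mulC !mulmxA.
by rewrite (mulmx_unitary_tC bath_rotation_unitary) mul1mx.
Qed.

Lemma joint_energy_rotation v w X :
  joint_energy (udiag P v) (udiag Q w) X =
  T^t* *m joint_energy (diag_mx v) (diag_mx w) X *m T.
Proof.
rewrite /joint_energy -tensmx1 !mulmxDr !mulmxDl !bath_rotation_conj !mulmx1.
by rewrite (mulmx_tC_unitary P_unit) (mulmx_tC_unitary Q_unit).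
Qed.

Lemma comm_mx_rotation U v w X :
  comm_mx U (joint_energy (udiag P v) (udiag Q w) X) ->
  comm_mx (T *m U *m T^t*) (joint_energy (diag_mx v) (diag_mx w) X).
Proof.
rewrite joint_energy_rotation /comm_mx; set E := joint_energy _ _ _ => UE.
have TT := mulmx_unitary_tC bath_rotation_unitary.
transitivity (T *m (U *m (T^t* *m E *m T)) *m T^t*).
  by rewrite !mulmxA -[RHS]mulmxA TT mulmx1.
by rewrite UE !mulmxA TT mul1mx.
Qed.

Lemma sum_bath_block_channel_rotation U v w rho :
  \sum_k bath_block (U *m (udiag P v *t (udiag Q w *t rho)) *m U^t*) k k =
  \sum_k bath_block ((T *m U *m T^t*) *m (diag_mx v *t (diag_mx w *t rho))
    *m (T *m U *m T^t*)^t*) k k.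
Proof.
rewrite -bath_rotation_conj -[RHS]sum_bath_block_rotation.
apply: eq_bigr => k _; congr (bath_block _ k k).
rewrite !trmx_mul !map_mxM trmxCK !mulmxA.
by rewrite !(mulmx_tC_unitary bath_rotation_unitary) mul1mx -[RHS]mulmxA
  (mulmx_tC_unitary bath_rotation_unitary) mulmx1.
Qed.

End BathRotation.
End BathBlocks.

(** * Translation between semilocal thermal operations and blocks *)

Section Conversion.
Variables (R : realType) (dA dB : nat).
Variables (HA : 'M[R[i]]_dA) (HB : 'M[R[i]]_dB) (betaA betaB : R).

Definition sys_energy : 'M[R[i]]_(dA * dB) := HA *t 1%:M + 1%:M *t HB.
Definition sys_weighted : 'M[R[i]]_(dA * dB) :=
  betaA%:C *: (HA *t 1%:M) + betaB%:C *: (1%:M *t HB).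

Section Dims.
Variables n1 n2 : nat.

Lemma ptrace2 (X : 'M[R[i]]_(n1 * (n2 * (dA * dB)))) :
  ptrace (ptrace X) = \sum_k bath_block X k k.
Proof.
apply/matrixP => s t; rewrite mxE summxE.
under eq_bigr do rewrite mxE.
rewrite exchange_big pair_bigA; apply: eq_bigr => k _.
by rewrite mxE.
Qed.

Lemma total_energyE (K1 : 'M[R[i]]_n1) (K2 : 'M[R[i]]_n2) :
  total_energy K1 K2 HA HB = joint_energy K1 K2 sys_energy.
Proof. by rewrite /joint_energy /sys_energy !tensmxDr. Qed.

Lemma weighted_energyE (K1 : 'M[R[i]]_n1) (K2 : 'M[R[i]]_n2) :
  weighted_energy betaA betaB K1 K2 HA HB =
  joint_energy (betaA%:C *: K1) (betaB%:C *: K2) sys_weighted.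
Proof.
rewrite /joint_energy /sys_weighted !tensmxDr !tensmxZr !tensmxZl !tensmxZr.
exact: scalerDD.
Qed.

End Dims.

Lemma thermal_blocks_SLTO_ord n1 n2 (a : 'I_n1 -> R) (b : 'I_n2 -> R) Lambda :
  (0 < n1)%N -> (0 < n2)%N ->
  thermal_blocks sys_energy sys_weighted
    (fun x => a x.1 + b x.2) (fun x => betaA * a x.1 + betaB * b x.2) Lambda ->
  is_SLTO betaA betaB HA HB Lambda.
Proof.
move=> n1_gt0 n2_gt0 [V [V1 VE VF VL]].
exists n1, n2, (diag_mx (real_row a)), (diag_mx (real_row b)), (of_bath_blocks V); split=> //.
- by split; exact: diag_real_row_hermsymmx.
- apply/unitarymx_bath_block => k k'; rewrite -V1.
  by apply: eq_bigr => l _; rewrite !of_bath_blocksK.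
(* Diagonal matrices are viewed as [udiag 1%:M] so that the lemmas on scaling and Gibbs states
   apply. *)
- split; [rewrite total_energyE|rewrite weighted_energyE -!udiag1 !udiagZ !real_rowZ !udiag1];
    apply/comm_mx_bath_block => k l; rewrite of_bath_blocksK !mxE -!rmorphD.
  + exact: VE.
  + exact: VF.
- move=> rho /VL ->; rewrite ptrace2 -!udiag1 !gibbs_udiag ?unitarymx1 // !udiag1.
  rewrite sum_bath_block_channel.
  apply: eq_bigr => k _; apply: eq_bigr => l _; rewrite !mxE -rmorphM of_bath_blocksK.
  by rewrite (partition_functionD (fun i => betaA * a i) (fun j => betaB * b j))
    opprD expRD invfM mulrACA.
Qed.

(** Matrices are indexed by ordinals, so the sums and products of index types built for the mixture
    are enumerated first. *)
Lemma thermal_blocks_SLTO (I J : finType) (a : I -> R) (b : J -> R) Lambda :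
  (0 < #|I|)%N -> (0 < #|J|)%N ->
  thermal_blocks sys_energy sys_weighted
    (fun x => a x.1 + b x.2) (fun x => betaA * a x.1 + betaB * b x.2) Lambda ->
  is_SLTO betaA betaB HA HB Lambda.
Proof.
move=> I_gt0 J_gt0 B.
apply: (@thermal_blocks_SLTO_ord _ _ (a \o enum_val) (b \o enum_val) _ I_gt0 J_gt0).
apply: (thermal_blocks_reindex
  (g := fun x : 'I_#|I| * 'I_#|J| => (enum_val x.1, enum_val x.2))) B => //.
exists (fun y => (enum_rank y.1, enum_rank y.2)) => -[i j] /=.
  by rewrite !enum_valK.
by rewrite !enum_rankK.
Qed.

(** Both bath Hamiltonians are diagonalized, and the blocks are those of the unitary conjugated by
    the bath rotation; this changes neither the channel nor the conservation laws. *)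
Lemma SLTO_thermal_blocks Lambda :
  is_SLTO betaA betaB HA HB Lambda ->
  exists n1 n2 (a : 'I_n1 -> R) (b : 'I_n2 -> R),
    [/\ (0 < n1)%N, (0 < n2)%N & thermal_blocks sys_energy sys_weighted
    (fun x => a x.1 + b x.2) (fun x => betaA * a x.1 + betaB * b x.2) Lambda].
Proof.
move=> [n1 [n2 [K1 [K2 [U [[n1_gt0 n2_gt0] [K1h K2h] Uu [UE UW] UL]]]]]].
have [P [a [Pu aE]]] := hermitian_udiag_real K1h.
have [Q [b [Qu bE]]] := hermitian_udiag_real K2h.
exists n1, n2, a, b; split=> //.
pose T := bath_rotation (dA * dB) P Q.
pose U' := T *m U *m T^t*.
exists (bath_block U'); split.
- exact/unitarymx_bath_block/bath_rotation_conj_unitary.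
- move=> k l; move: UE; rewrite total_energyE aE bE.
  move=> /(comm_mx_rotation Pu Qu) /comm_mx_bath_block /(_ k l).
  by rewrite !mxE -!rmorphD.
- move=> k l; move: UW; rewrite weighted_energyE aE bE !udiagZ !real_rowZ.
  move=> /(comm_mx_rotation Pu Qu) /comm_mx_bath_block /(_ k l).
  by rewrite !mxE -!rmorphD.
- move=> rho /UL ->; rewrite ptrace2 aE bE !gibbs_udiag //.
  rewrite sum_bath_block_channel_rotation // sum_bath_block_channel.
  apply: eq_bigr => k _; apply: eq_bigr => l _; rewrite !mxE -rmorphM.
  by rewrite (partition_functionD (fun i => betaA * a i) (fun j => betaB * b j))
    opprD expRD invfM mulrACA.
Qed.

End Conversion.

Theorem theorem5 (R : realType) (dA dB : nat)
    (dA_gt0 : (0 < dA)%N) (dB_gt0 : (0 < dB)%N)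
    (HA : 'M[R[i]]_dA) (HB : 'M[R[i]]_dB)
    (HA_herm : HA \is hermsymmx) (HB_herm : HB \is hermsymmx)
    (betaA betaB : R) (betaA_gt0 : 0 < betaA) (betaB_gt0 : 0 < betaB)
    (Lambda1 Lambda2 : 'M[R[i]]_(dA * dB) -> 'M[R[i]]_(dA * dB)) :
  is_SLTO betaA betaB HA HB Lambda1 ->
  is_SLTO betaA betaB HA HB Lambda2 ->
  forall alpha : R, 0 <= alpha <= 1 ->
  is_SLTO betaA betaB HA HB
    (fun rho => alpha%:C *: Lambda1 rho + (1 - alpha)%:C *: Lambda2 rho).
Proof.
move=> S1 S2 alpha /andP[alpha_ge0 alpha_le1].
(* At the endpoints no finite energy shift gives the required weights, but the mixture is one of the
   two given maps. *)
have [alpha0|alpha_neq0] := eqVneq alpha 0.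
  suff -> : (fun rho => alpha%:C *: Lambda1 rho + (1 - alpha)%:C *: Lambda2 rho)
      = Lambda2 by [].
  by apply/funext => rho; rewrite alpha0 subr0 rmorph0 rmorph1 scale0r add0r scale1r.
have [alpha1|alpha_neq1] := eqVneq alpha 1.
  suff -> : (fun rho => alpha%:C *: Lambda1 rho + (1 - alpha)%:C *: Lambda2 rho)
      = Lambda1 by [].
  by apply/funext => rho; rewrite alpha1 subrr rmorph0 rmorph1 scale0r addr0 scale1r.
have alpha01 : 0 < alpha < 1.
  by rewrite lt_neqAle eq_sym alpha_neq0 alpha_ge0 lt_neqAle alpha_neq1.
have [m1 [m2 [a1 [b1 [m1_gt0 m2_gt0 B1]]]]] := SLTO_thermal_blocks S1.
have [n1 [n2 [a2 [b2 [n1_gt0 n2_gt0 B2]]]]] := SLTO_thermal_blocks S2.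
have [||||a [b B]] := thermal_blocks_convex (lt0r_neq0 betaA_gt0) alpha01 _ _ _ _ B1 B2;
  rewrite ?card_ord //.
apply: thermal_blocks_SLTO B.
- by rewrite card_sum !card_ord addn_gt0 m1_gt0.
- by rewrite card_prod !card_ord muln_gt0 m2_gt0.
Qed.
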